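(* Every extended-real-valued semi-algebraic function $h:\mathbb{R}^n\to\mathbb{R}\cup\{\pm\infty\}$ is the optimistic value function of some polynomial bilevel problem whose lower-level problem is unconstrained (i.e. $\mathcal{Y}=\mathbb{R}^m$ for some $m$), and is also the pessimistic value function of some such problem. In particular, $$\mathcal{P}^{\mathrm{optim}}_{\mathrm{unbound}}=\mathcal{P}^{\mathrm{pessim}}_{\mathrm{unbound}}=\mathcal{SA}.$$
   Context: Bilevel problem data: polynomials $P,Q:\mathbb{R}^n\times\mathbb{R}^m\to\mathbb{R}$ and a box $\mathcal{Y}=[a_1,b_1]\times\cdots\times[a_m,b_m]$, $a_i,b_i\in\mathbb{R}\cup\{\pm\infty\}$. The box is unbounded if some $a_i=-\infty$ or some $b_i=+\infty$, bounded otherwise. $\Theta(x):=\arg\min_{y\in\mathcal{Y}}Q(x,y)$; $\varphi_o(x)=\inf_{y\in\Theta(x)}P(x,y)$, $\varphi_p(x)=\sup_{y\in\Theta(x)}P(x,y)$, with $\varphi_o(x)=+\infty$, $\varphi_p(x)=-\infty$ if $\Theta(x)=\emptyset$. $\mathcal{P}^{\mathrm{optim}}_{\mathrm{unbound}}$ (resp. $\mathcal{P}^{\mathrm{pessim}}_{\mathrm{unbound}}$) is the set of functions $h$ on $\mathbb{R}^n$ for which there exist $m$, polynomials $P,Q$ and an unbounded box $\mathcal{Y}\subseteq\mathbb{R}^m$ with $\varphi_o=h$ (resp. $\varphi_p=h$). A basic semi-algebraic set is $\{x\mid P(x)=0,\ Q_j(x)>0,\ j\in J\}$ ($J$ finite,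 $P,Q_j$ polynomials); semi-algebraic sets are finite unions of these; a function is semi-algebraic if its graph is. $\mathcal{SA}$ is the class of extended-real-valued semi-algebraic functions $f:\mathbb{R}^n\to\mathbb{R}\cup\{\pm\infty\}$: those for which $\{f\in\mathbb{R}\}$, $\{f=+\infty\}$, $\{f=-\infty\}$ are semi-algebraic and $f$ restricted to $\{f\in\mathbb{R}\}$ is semi-algebraic. *)

(* Defs.v *)
From mathcomp Require Import all_boot all_order all_algebra.
(* mpoly must be imported before the analysis files: in the other order the
   notation levels clash. *)
From mathcomp Require Import mpoly.
From mathcomp Require Import boolp classical_sets functions reals.
From mathcomp Require Import constructive_ereal ereal.

Set Implicit Arguments.
Unset Strict Implicit.
Unset Printing Implicit Defensive.

Import Order.TTheory GRing.Theory Num.Theory.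

Local Open Scope classical_set_scope.
Local Open Scope ring_scope.

Section SemiAlgebraic.
Variable R : realType.

Definition evalp n (p : {mpoly R[n]}) (x : 'rV[R]_n) : R := p.@[x 0].

Definition basic_semialgebraic n (A : set 'rV[R]_n) : Prop :=
  exists (k : nat) (P : {mpoly R[n]}) (Q : 'I_k -> {mpoly R[n]}),
    A = [set x | evalp P x = 0 /\ forall j, 0 < evalp (Q j) x].

Definition semialgebraic n (A : set 'rV[R]_n) : Prop :=
  exists (k : nat) (B : 'I_k -> set 'rV[R]_n),
    (forall i, basic_semialgebraic (B i)) /\ A = \bigcup_(i in setT) B i.

Definition graph_on n (D : set 'rV[R]_n) (f : 'rV[R]_n -> R) :
  set 'rV[R]_(n + 1) := [set row_mx x (f x)%:M | x in D].

Definition semialgebraic_fun_on n (D : set 'rV[R]_n) (f : 'rV[R]_n -> R) :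
  Prop := semialgebraic (graph_on D f).

Definition SA n : set ('rV[R]_n -> \bar R) :=
  [set f | [/\ semialgebraic [set x | f x \is a fin_num],
               semialgebraic [set x | f x = +oo%E],
               semialgebraic [set x | f x = -oo%E] &
               semialgebraic_fun_on [set x | f x \is a fin_num]
                                    (fun x => fine (f x))]].

End SemiAlgebraic.

Section Bilevel.
Variable R : realType.

Definition box m (a b : 'I_m -> \bar R) : set 'rV[R]_m :=
  [set y | forall i, (a i <= (y 0 i)%:E <= b i)%E].

(* Through the bounds, as they are given: an empty box may have an infinite
   bound too. *)
Definition unbounded_box m (a b : 'I_m -> \bar R) : Prop :=
  exists i, a i = -oo%E \/ b i = +oo%E.

Section Values.
Variables (n m : nat) (P Q : {mpoly R[n + m]}) (Y : set 'rV[R]_m).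

Definition lower_argmin (x : 'rV[R]_n) : set 'rV[R]_m :=
  [set y | Y y /\
           forall z, Y z -> evalp Q (row_mx x y) <= evalp Q (row_mx x z)].

(* [ereal_inf set0 = +oo] and [ereal_sup set0 = -oo], which are the values
   prescribed when the lower-level problem has no minimizer. *)
Definition optim_value (x : 'rV[R]_n) : \bar R :=
  ereal_inf [set (evalp P (row_mx x y))%:E | y in lower_argmin x].

Definition pessim_value (x : 'rV[R]_n) : \bar R :=
  ereal_sup [set (evalp P (row_mx x y))%:E | y in lower_argmin x].

End Values.

Definition optim_unbound n : set ('rV[R]_n -> \bar R) :=
  [set h | exists (m : nat) (P Q : {mpoly R[n + m]}) (a b : 'I_m -> \bar R),
      unbounded_box a b /\ optim_value P Q (box a b) = h].

Definition pessim_unbound n : set ('rV[R]_n -> \bar R) :=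
  [set h | exists (m : nat) (P Q : {mpoly R[n + m]}) (a b : 'I_m -> \bar R),
      unbounded_box a b /\ pessim_value P Q (box a b) = h].

End Bilevel.

Arguments SA : clear implicits.
Arguments optim_unbound : clear implicits.
Arguments pessim_unbound : clear implicits.

(* Main.v *)
(** A semialgebraic set S of R^N is the projection of the zero set of a
    polynomial F >= 0: the conditions Q_j > 0 become Q_j z_j^2 = 1, conjunctions
    are sums of squares and unions are products.  For S the set of the (x, t)
    with h x = t or h x = -oo, the lower-level objective
      Q(x, (t, z, u, v)) = F(x, t, z) ((u v - 1)^2 + u^2)
    has the zeros of F as its minimizers, and no others: the second factor is
    positive with infimum 0.  Minimizing P = t over them yields h x, the value
    +oo corresponding to a lower-level problem without minimizers.  Conversely,
    that the value at x is below t is a first-order condition on (x, t), so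
    quantifier elimination makes the value function semialgebraic.  The
    pessimistic case follows by negating P and h. *)
Require Import Defs.
From mathcomp Require Import all_boot all_order all_algebra.
From mathcomp Require Import mpoly.
From mathcomp Require Import boolp classical_sets functions reals.
From mathcomp Require Import constructive_ereal ereal.
From mathcomp.real_closed Require ordered_qelim qe_rcf.
From mathcomp Require Import lra.

Set Implicit Arguments.
Unset Strict Implicit.
Unset Printing Implicit Defensive.

Import Order.TTheory GRing.Theory Num.Theory.
Import ordered_qelim.

Local Open Scope classical_set_scope.
Local Open Scope ring_scope.

(** * Finite unions and intersections of semialgebraic sets *)

Section Semialgebraic.
Variable R : realType.

Lemma evalpM n (p q : {mpoly R[n]}) x : evalp (p * q) x = evalp p x * evalp q x.
Proof. exact: mevalM. Qed.

Lemma evalpD n (p q : {mpoly R[n]}) x : evalp (p + q) x = evalp p x + evalp q x.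
Proof. exact: mevalD. Qed.

Lemma evalpN n (p : {mpoly R[n]}) x : evalp (- p) x = - evalp p x.
Proof. exact: mevalN. Qed.

Lemma evalpB n (p q : {mpoly R[n]}) x : evalp (p - q) x = evalp p x - evalp q x.
Proof. exact: mevalB. Qed.

Lemma evalpC n (c : R) (x : 'rV_n) : evalp c%:MP x = c.
Proof. exact: mevalC. Qed.

Lemma evalpX n (i : 'I_n) (x : 'rV[R]_n) : evalp 'X_i x = x 0 i.
Proof. exact: mevalXU. Qed.

Lemma sumsqr_eq0 (a b : R) : (a ^+ 2 + b ^+ 2 = 0) <-> (a = 0 /\ b = 0).
Proof.
split=> [/eqP|[-> ->]]; last by rewrite !expr0n addr0.
by rewrite paddr_eq0 ?sqr_ge0// !sqrf_eq0 => /andP[/eqP-> /eqP->].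
Qed.

Lemma eq_semialgebraic n (A B : set 'rV[R]_n) :
  (forall x, A x <-> B x) -> semialgebraic A -> semialgebraic B.
Proof.
by move=> AB; suff -> : A = B by []; apply/funext => x; apply/propext.
Qed.

(** Allowing any finite index type lets sum types index a joint list of inequalities, and [void] and
    [unit] the lists of length zero and one, without arithmetic on ordinals. *)
Lemma basic_semialgebraic_fin n (J : finType) (P : {mpoly R[n]})
    (Q : J -> {mpoly R[n]}) :
  basic_semialgebraic [set x | evalp P x = 0 /\ forall j, 0 < evalp (Q j) x].
Proof.
exists #|J|, P, (Q \o enum_val); apply/seteqP.
split=> x /= [Px Qx]; split=> // j.
by have := Qx (enum_rank j); rewrite enum_rankK.
Qed.

(** Over the reals two equations merge into one, a sum of two squares being zero only if both terms
    are; the lists of inequalities are concatenated. *)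
Lemma basic_semialgebraicI n (A B : set 'rV[R]_n) :
  basic_semialgebraic A -> basic_semialgebraic B -> basic_semialgebraic (A `&` B).
Proof.
move=> [k [P [Q ->]]] [l [P' [Q' ->]]].
pose Q2 (j : 'I_k + 'I_l) := match j with inl j => Q j | inr j => Q' j end.
have := @basic_semialgebraic_fin _ _ (P ^+ 2 + P' ^+ 2) Q2.
congr basic_semialgebraic; apply/seteqP; split=> x /=.
  rewrite evalpD !expr2 !evalpM -!expr2 => -[/sumsqr_eq0[P0 P'0] Qx].
  by split; split=> // j; [have := Qx (inl j)|have := Qx (inr j)].
case=> -[P0 Qx] [P'0 Q'x]; split; last by case=> j /=.
by rewrite evalpD !expr2 !evalpM P0 P'0 mulr0 addr0.
Qed.

Lemma semialgebraic_fin n (I : finType) (B : I -> set 'rV[R]_n) :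
  (forall i, basic_semialgebraic (B i)) -> semialgebraic [set x | exists i, B i x].
Proof.
move=> bB; exists #|I|, (B \o enum_val); split=> [i|]; first exact: bB.
apply/seteqP; split=> x /= [i]; last by move=> _ Bx; exists (enum_val i).
by move=> Bx; exists (enum_rank i) => //=; rewrite enum_rankK.
Qed.

Lemma basic_semialgebraicW n (A : set 'rV[R]_n) :
  basic_semialgebraic A -> semialgebraic A.
Proof.
move=> bA; have := @semialgebraic_fin _ unit (fun=> A) (fun=> bA).
by apply: eq_semialgebraic => x /=; split=> [[]//|]; exists tt.
Qed.

Lemma semialgebraicU n (A B : set 'rV[R]_n) :
  semialgebraic A -> semialgebraic B -> semialgebraic (A `|` B).
Proof.
move=> [k [C [bC ->]]] [l [D [bD ->]]].
pose E (j : 'I_k + 'I_l) := match j with inl j => C j | inr j => D j end.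
have /semialgebraic_fin : forall j, basic_semialgebraic (E j) by case.
apply: eq_semialgebraic => x /=; split.
  by case=> -[j|j] Ex; [left|right]; exists j.
by case=> -[j _ Ex]; [exists (inl j)|exists (inr j)].
Qed.

(** By distributivity, the intersection of two unions is the union of the pairwise intersections of
    their basic pieces. *)
Lemma semialgebraicI n (A B : set 'rV[R]_n) :
  semialgebraic A -> semialgebraic B -> semialgebraic (A `&` B).
Proof.
move=> [k [C [bC ->]]] [l [D [bD ->]]].
pose E (j : 'I_k * 'I_l) := C j.1 `&` D j.2.
have /semialgebraic_fin : forall j, basic_semialgebraic (E j).
  by move=> j; exact: basic_semialgebraicI.
apply: eq_semialgebraic => x /=; split.
  by case=> -[i j] [Cx Dx]; split; [exists i|exists j].
by case=> -[i _ Cx] [j _ Dx]; exists (i, j).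
Qed.

Lemma semialgebraic0 n : semialgebraic (set0 : set 'rV[R]_n).
Proof.
have /semialgebraic_fin : forall i : void, basic_semialgebraic
  (set0 : set 'rV[R]_n) by [].
by apply: eq_semialgebraic => x /=; split=> // -[].
Qed.

Lemma semialgebraic_eq0 n (p : {mpoly R[n]}) :
  semialgebraic [set x | evalp p x = 0].
Proof.
apply: basic_semialgebraicW.
have := @basic_semialgebraic_fin _ void p (fun=> 0).
by congr basic_semialgebraic; apply/seteqP; split=> x /=; [case|split].
Qed.

Lemma semialgebraic_gt0 n (p : {mpoly R[n]}) :
  semialgebraic [set x | 0 < evalp p x].
Proof.
apply: basic_semialgebraicW.
have := @basic_semialgebraic_fin _ unit 0 (fun=> p).
congr basic_semialgebraic; apply/seteqP; split=> x /= => [[_ /(_ tt)]//|px].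
by split=> //; rewrite /evalp meval0.
Qed.

Lemma semialgebraicT n : semialgebraic (setT : set 'rV[R]_n).
Proof.
by apply: eq_semialgebraic (semialgebraic_eq0 0) => x /=; rewrite /evalp meval0.
Qed.

(** * First-order definability and quantifier elimination *)

Definition env n (x : 'rV[R]_n) : seq R := [seq x 0 i | i <- enum 'I_n].

Lemma nth_env n (x : 'rV[R]_n) (i : 'I_n) : nth 0 (env x) i = x 0 i.
Proof. by rewrite (nth_map i) ?size_enum_ord// nth_ord_enum. Qed.

Lemma nth_env_ge n (x : 'rV[R]_n) i : (n <= i)%N -> nth 0 (env x) i = 0.
Proof. by move=> ni; rewrite nth_default// size_map size_enum_ord. Qed.

(** [rterm] excludes inverses, so only ring operations remain. A variable of index at least [n]
    reads the default value 0 of the environment and becomes the zero polynomial. *)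
Lemma mpoly_of_term n (t : GRing.term R) : GRing.rterm t ->
  exists p : {mpoly R[n]}, forall x, GRing.eval (env x) t = evalp p x.
Proof.
elim: t => //=.
- move=> i _; have [ni|ni] := ltnP i n.
    by exists 'X_(Ordinal ni) => x; rewrite evalpX -nth_env.
  by exists 0 => x; rewrite nth_env_ge// /evalp meval0.
- by move=> c _; exists c%:MP => x; rewrite evalpC.
- by move=> k _; exists (k%:R)%:MP => x; rewrite evalpC.
- move=> s IHs t IHt /andP[/IHs[p ps] /IHt[q qt]]; exists (p + q) => x.
  by rewrite evalpD ps qt.
- by move=> s IHs /IHs[p ps]; exists (- p) => x; rewrite evalpN ps.
- move=> s IHs k /IHs[p ps]; exists (p *+ k) => x.
  by rewrite /evalp mevalMn -/(evalp p x) ps.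
- move=> s IHs t IHt /andP[/IHs[p ps] /IHt[q qt]]; exists (p * q) => x.
  by rewrite evalpM ps qt.
- move=> s IHs k /IHs[p ps]; exists (p ^+ k) => x.
  by rewrite /evalp rmorphXn /= -/(evalp p x) ps.
Qed.

Lemma term_of_mpoly n (p : {mpoly R[n]}) :
  exists t : GRing.term R, forall x, GRing.eval (env x) t = evalp p x.
Proof.
rewrite [p]mpolyE; elim/big_ind: _.
- by exists (GRing.NatConst _ 0) => x; rewrite /evalp meval0.
- move=> q r [s sq] [t tr]; exists (GRing.Add s t) => x.
  by rewrite evalpD /= sq tr.
move=> m _.
suff [t tm] : exists t : GRing.term R, forall x : 'rV_n,
    GRing.eval (env x) t = evalp 'X_[m] x.
  by exists (GRing.Mul (GRing.Const p@_m) t) => x; rewrite /evalp mevalZ /= tm.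
(* A monomial is a product of powers of variables, each of which is a term. *)
rewrite [X in evalp X]mpolyXE_id; elim/big_ind: _.
- by exists (GRing.NatConst _ 1) => x; rewrite /evalp meval1.
- move=> q r [s sq] [t tr]; exists (GRing.Mul s t) => x.
  by rewrite evalpM /= sq tr.
move=> i _; exists (GRing.Exp (GRing.Var _ i) (m i)) => x.
by rewrite /evalp rmorphXn /= mevalXU nth_env.
Qed.

Definition definable n (A : set 'rV[R]_n) :=
  exists f : ord.formula R, forall x, A x <-> ord.holds (env x) f.

Lemma holds_foldr_and (T : eqType) (f : T -> ord.formula R) (s : seq T) e :
  ord.holds e (foldr (fun i => ord.And (f i)) (ord.Bool true) s) <->
  forall i, i \in s -> ord.holds e (f i).
Proof.
elim: s => [|i s IHs] /=; first by split.
split=> [[fi /IHs fs] j|fs].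
  by rewrite inE => /predU1P[->|/fs].
by split; [|apply/IHs => j js]; apply: fs; rewrite inE ?eqxx// js orbT.
Qed.

Lemma holds_foldr_or (T : eqType) (f : T -> ord.formula R) (s : seq T) e :
  ord.holds e (foldr (fun i => ord.Or (f i)) (ord.Bool false) s) <->
  exists2 i, i \in s & ord.holds e (f i).
Proof.
elim: s => [|i s IHs] /=; first by split=> // -[].
split=> [[fi|/IHs[j js fj]]|[j]].
- by exists i => //; rewrite inE eqxx.
- by exists j => //; rewrite inE js orbT.
- by rewrite inE => /predU1P[->|js fj]; [left|right; apply/IHs; exists j].
Qed.

Lemma semialgebraic_definable n (A : set 'rV[R]_n) :
  semialgebraic A -> definable A.
Proof.
move=> [k [B [bB ->]]].
have /choice[f fB] : forall i, definable (B i).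
  move=> i; have [l [P [Q ->]]] := bB i.
  have [s sP] := term_of_mpoly P.
  have /choice[t tQ] := fun j => term_of_mpoly (Q j).
  exists (ord.And (ord.Equal s (GRing.NatConst _ 0))
    (foldr (fun j => ord.And (ord.Lt (GRing.NatConst _ 0) (t j)))
       (ord.Bool true) (enum 'I_l))) => x.
  have := holds_foldr_and (fun j => ord.Lt (GRing.NatConst _ 0) (t j))
    (enum 'I_l) (env x).
  move=> /= ->; rewrite sP; split=> -[P0 Qx]; split=> // j.
    by rewrite tQ.
  by have := Qx j (mem_enum _ j); rewrite tQ.
exists (foldr (fun i => ord.Or (f i)) (ord.Bool false) (enum 'I_k)) => x.
rewrite holds_foldr_or; split=> [[i _]|[i _]]; rewrite ?fB -?fB => Bx.
  by exists i; rewrite ?mem_enum//; exact/fB.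
by exists i => //; exact/fB.
Qed.

(** The set and its complement are carried through the induction together: negation exchanges them
    and implication uses both. Closure under complement is itself derived from this lemma. *)
Lemma qf_semialgebraic n (f : ord.formula R) :
  ord.qf_form f && ord.rformula f ->
  semialgebraic [set x : 'rV[R]_n | ord.qf_eval (env x) f] /\
  semialgebraic [set x : 'rV[R]_n | ~~ ord.qf_eval (env x) f].
Proof.
have lt_le (p q : {mpoly R[n]}) :
    semialgebraic [set x | evalp p x < evalp q x] /\
    semialgebraic [set x | evalp p x <= evalp q x].
  have pq : semialgebraic [set x | evalp p x < evalp q x].
    apply: eq_semialgebraic (semialgebraic_gt0 (q - p)) => x /=.
    by rewrite evalpB subr_gt0.
  split=> //.
  apply: eq_semialgebraic (semialgebraicU pq (semialgebraic_eq0 (q - p))) => x /=.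
  rewrite evalpB le_eqVlt; split=> [[->|/eqP]|/predU1P[->|->]].
  - by rewrite orbT.
  - by rewrite subr_eq0 eq_sym => ->.
  - by right; rewrite subrr.
  - by left.
elim: f => //=.
- by case=> _; split; first
    [ apply: eq_semialgebraic (semialgebraicT _) => x /=; by split
    | apply: eq_semialgebraic (semialgebraic0 _) => x /=; by split ].
- move=> s t /andP[/(@mpoly_of_term n)[p ps] /(@mpoly_of_term n)[q qt]].
  under eq_set do rewrite ps qt; under [in X in _ /\ X]eq_set do rewrite ps qt.
  split.
    apply: eq_semialgebraic (semialgebraic_eq0 (p - q)) => x /=.
    by rewrite evalpB -subr_eq0; split=> /eqP.
  apply: eq_semialgebraic (semialgebraicU (lt_le p q).1 (lt_le q p).1) => x /=.
  by rewrite neq_lt; split=> /orP.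
- move=> s t /andP[/(@mpoly_of_term n)[p ps] /(@mpoly_of_term n)[q qt]].
  under eq_set do rewrite ps qt; under [in X in _ /\ X]eq_set do rewrite ps qt.
  split; first exact: (lt_le p q).1.
  by apply: eq_semialgebraic (lt_le q p).2 => x /=; rewrite leNgt.
- move=> s t /andP[/(@mpoly_of_term n)[p ps] /(@mpoly_of_term n)[q qt]].
  under eq_set do rewrite ps qt; under [in X in _ /\ X]eq_set do rewrite ps qt.
  split; first exact: (lt_le p q).2.
  by apply: eq_semialgebraic (lt_le q p).1 => x /=; rewrite ltNge.
- move=> f IHf g IHg; rewrite andbACA => /andP[/IHf[f1 f0] /IHg[g1 g0]].
  split; [apply: eq_semialgebraic (semialgebraicI f1 g1)|
          apply: eq_semialgebraic (semialgebraicU f0 g0)] => x /=.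
    by split=> /andP.
  by rewrite negb_and; split=> /orP.
- move=> f IHf g IHg; rewrite andbACA => /andP[/IHf[f1 f0] /IHg[g1 g0]].
  split; [apply: eq_semialgebraic (semialgebraicU f1 g1)|
          apply: eq_semialgebraic (semialgebraicI f0 g0)] => x /=.
    by split=> /orP.
  by rewrite negb_or; split=> /andP.
- move=> f IHf g IHg; rewrite andbACA => /andP[/IHf[f1 f0] /IHg[g1 g0]].
  split; [apply: eq_semialgebraic (semialgebraicU f0 g1)|
          apply: eq_semialgebraic (semialgebraicI f1 g0)] => x /=.
    by rewrite implybE; split=> /orP.
  by rewrite negb_imply; split=> /andP.
- move=> f IHf /IHf[f1 f0]; split=> //.
  by apply: eq_semialgebraic f1 => x /=; rewrite negbK.
Qed.

(** [to_rform] removes the inverses from the formula, then quantifier elimination for real closed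
    fields leaves a quantifier-free formula in ring terms. *)
Lemma definable_semialgebraic n (A : set 'rV[R]_n) :
  definable A -> semialgebraic A.
Proof.
move=> [f Af].
have rf := ord.to_rform_rformula f.
have wf := @qe_rcf.wf_QE_wproj R; have valid := @qe_rcf.valid_QE_wproj R.
have [+ _] := @qf_semialgebraic n _ (ord.quantifier_elim_wf wf rf).
apply: eq_semialgebraic => x /=; rewrite Af -ord.to_rformP.
exact: iff_sym (rwP (ord.quantifier_elim_rformP wf valid (env x) rf)).
Qed.

(** On the side of formulas complementation is mere negation, so the detour through definability
    gives it at once. *)
Lemma semialgebraicC n (A : set 'rV[R]_n) :
  semialgebraic A -> semialgebraic (~` A).
Proof.
move=> /semialgebraic_definable[f Af]; apply: definable_semialgebraic.
by exists (ord.Not f) => x /=; rewrite -Af.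
Qed.

(** Quantifying a block of variables means choosing a new environment that may differ from the old
    one only at their indices. *)
Lemma holds_foldr_exists (f : ord.formula R) (I : seq nat) e :
  (exists2 e', {in [predC I], GRing.same_env e e'} & ord.holds e' f) <->
  ord.holds e (foldr ord.Exists f I).
Proof.
elim: I e => /= [|i I IHi] e.
  by split=> [[e' eq_e] |]; [apply: ord.eq_holds => i; rewrite eq_e | exists e].
split=> [[e' eq_e f_e'] | [y]].
  exists (nth 0 e' i); apply/IHi; exists e' => // j.
  by have := eq_e j; rewrite nth_set_nth /= !inE; case: eqP => // ->.
case/IHi=> e' eq_e f_e'; exists e' => // j.
by have := eq_e j; rewrite nth_set_nth /= !inE; case: eqP.
Qed.

(* Tarski-Seidenberg *)
Lemma semialgebraic_ex n m (A : 'rV[R]_n -> 'rV[R]_m -> Prop) :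
  semialgebraic [set w : 'rV_(n + m) | A (lsubmx w) (rsubmx w)] ->
  semialgebraic [set x | exists y, A x y].
Proof.
move=> /semialgebraic_definable[f Af]; apply: definable_semialgebraic.
(* In the environment of the pair of [x] and [y], the coordinates of [y] are the variables from [n]
   to [n + m - 1]; exactly these are quantified. *)
exists (foldr ord.Exists f (iota n m)) => x /=.
rewrite -holds_foldr_exists; split=> [[y Axy]|[e' ee' fe']].
  exists (env (row_mx x y)); last by apply/Af; rewrite /= row_mxKl row_mxKr.
  move=> i; rewrite !inE mem_iota => ni; have [lin|] := ltnP i n.
    have -> : i = lshift m (Ordinal lin) by [].
    by rewrite [RHS]nth_env row_mxEl -nth_env.
  move=> lni; rewrite !nth_env_ge//.
  by move: ni; rewrite lni /= -leqNgt.
exists (\row_(j < m) nth 0 e' (n + j)).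
suff fy : ord.holds (env (row_mx x (\row_(j < m) nth 0 e' (n + j)))) f.
  by have := (Af _).2 fy; rewrite /= row_mxKl row_mxKr.
(* Outside the quantified block [e'] agrees with the environment of [x]; in particular it is 0 from
   [n + m] on, like the environment of the pair. *)
have eE i : ~~ (n <= i < n + m)%N -> nth 0 (env x) i = nth 0 e' i.
  by move=> ni; apply: ee'; rewrite !inE mem_iota.
apply: ord.eq_holds fe' => i; have [lin|lni] := ltnP i n.
  rewrite -eE; last by rewrite leqNgt lin.
  have -> : i = lshift m (Ordinal lin) by [].
  by rewrite [RHS]nth_env row_mxEl -nth_env.
have [linm|lnmi] := ltnP i (n + m).
  have lim : (i - n < m)%N by rewrite ltn_subLR.
  have -> : i = rshift n (Ordinal lim) by rewrite /= subnKC.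
  by rewrite [RHS]nth_env row_mxEr mxE.
by rewrite -eE ?nth_env_ge// lni /= -leqNgt.
Qed.

(** Dual of projection, by complementing before and after it. *)
Lemma semialgebraic_all n m (A : 'rV[R]_n -> 'rV[R]_m -> Prop) :
  semialgebraic [set w : 'rV_(n + m) | A (lsubmx w) (rsubmx w)] ->
  semialgebraic [set x | forall y, A x y].
Proof.
move=> /semialgebraicC/(@semialgebraic_ex _ _ (fun x y => ~ A x y)).
move=> /semialgebraicC; apply: eq_semialgebraic => x /=.
by split=> [/forallNP Ax y|Ax [y]]; [exact: contrapT|exact].
Qed.

(** * Polynomial functions and maps, and preimages under them *)

Definition polyfun n (f : 'rV[R]_n -> R) := exists p, forall x, evalp p x = f x.

Definition polymap n m (g : 'rV[R]_n -> 'rV[R]_m) :=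
  forall i, polyfun (fun x => g x 0 i).

Lemma polyfun_cst n (c : R) : polyfun (fun _ : 'rV_n => c).
Proof. by exists c%:MP => x; rewrite evalpC. Qed.

Lemma polyfunD n (f g : 'rV_n -> R) :
  polyfun f -> polyfun g -> polyfun (fun x => f x + g x).
Proof. by move=> [p pf] [q qg]; exists (p + q) => x; rewrite evalpD pf qg. Qed.

Lemma polyfunN n (f : 'rV_n -> R) : polyfun f -> polyfun (fun x => - f x).
Proof. by move=> [p pf]; exists (- p) => x; rewrite evalpN pf. Qed.

Lemma polyfunM n (f g : 'rV_n -> R) :
  polyfun f -> polyfun g -> polyfun (fun x => f x * g x).
Proof. by move=> [p pf] [q qg]; exists (p * q) => x; rewrite evalpM pf qg. Qed.

Lemma polyfunX n (f : 'rV_n -> R) k : polyfun f -> polyfun (fun x => f x ^+ k).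
Proof.
by move=> [p pf]; exists (p ^+ k) => x; rewrite -pf /evalp rmorphXn.
Qed.

Lemma polyfun_sum n k (f : 'I_k -> 'rV_n -> R) :
  (forall i, polyfun (f i)) -> polyfun (fun x => \sum_i f i x).
Proof.
move=> /choice[p pf]; exists (\sum_i p i) => x.
by rewrite /evalp raddf_sum; apply: eq_bigr => i _; exact: pf.
Qed.

Lemma polyfun_coord n m (g : 'rV_n -> 'rV_m) i :
  polymap g -> polyfun (fun x => g x 0 i).
Proof. exact. Qed.

Lemma polyfun_comp n m (p : {mpoly R[m]}) (g : 'rV_n -> 'rV_m) :
  polymap g -> polyfun (fun x => evalp p (g x)).
Proof.
move=> /choice[q qg]; exists (p \mPo [tuple q i | i < m]) => x.
rewrite /evalp comp_mpoly_meval; apply: meval_eq => i.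
by rewrite tnth_mktuple; exact: qg.
Qed.

Lemma polymap_id n : polymap (fun x : 'rV_n => x).
Proof. by move=> i; exists 'X_i => x; rewrite evalpX. Qed.

Lemma polymap_lsub n m k (g : 'rV_n -> 'rV_(m + k)) :
  polymap g -> polymap (fun x => lsubmx (g x)).
Proof.
by move=> pg i; have [p pE] := pg (lshift k i); exists p => x; rewrite mxE.
Qed.

Lemma polymap_rsub n m k (g : 'rV_n -> 'rV_(m + k)) :
  polymap g -> polymap (fun x => rsubmx (g x)).
Proof.
by move=> pg i; have [p pE] := pg (rshift m i); exists p => x; rewrite mxE.
Qed.

Lemma polymap_row n m k (f : 'rV_n -> 'rV_m) (g : 'rV_n -> 'rV_k) :
  polymap f -> polymap g -> polymap (fun x => row_mx (f x) (g x)).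
Proof.
move=> pf pg i; have [j ->|j ->] := split_ordP i.
  by have [p pE] := pf j; exists p => x; rewrite row_mxEl.
by have [p pE] := pg j; exists p => x; rewrite row_mxEr.
Qed.

Lemma polymap_scalar n (f : 'rV_n -> R) :
  polyfun f -> polymap (fun x => (f x)%:M : 'rV_1).
Proof. by move=> [p pf] i; exists p => x; rewrite ord1 mxE eqxx mulr1n. Qed.

(** Composing every defining polynomial with [g] keeps the shape of a union of basic sets. This
    serves to permute, drop and regroup blocks of variables. *)
Lemma semialgebraic_preimage n m (g : 'rV_n -> 'rV_m) (A : set 'rV[R]_m) :
  polymap g -> semialgebraic A -> semialgebraic [set x | A (g x)].
Proof.
move=> pg [k [B [bB ->]]].
suff /semialgebraic_fin : forall i, basic_semialgebraic [set x | B i (g x)].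
  by apply: eq_semialgebraic => x /=; split=> [[i]|[i _]]; exists i.
move=> i; have [l [P [Q ->]]] := bB i.
have [p pP] := polyfun_comp P pg.
have /choice[q qQ] := fun j => polyfun_comp (Q j) pg.
exists l, p, q; apply/seteqP; split=> x /=; rewrite pP => -[-> Qx]; split=> // j.
  by rewrite qQ.
by rewrite -qQ.
Qed.

Lemma semialgebraic_lt n (f g : 'rV_n -> R) :
  polyfun f -> polyfun g -> semialgebraic [set x | f x < g x].
Proof.
move=> pf pg; have [p pE] := polyfunD pg (polyfunN pf).
by apply: eq_semialgebraic (semialgebraic_gt0 p) => x /=; rewrite pE subr_gt0.
Qed.

Lemma semialgebraic_le n (f g : 'rV_n -> R) :
  polyfun f -> polyfun g -> semialgebraic [set x | f x <= g x].
Proof.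
move=> pf pg; apply: eq_semialgebraic (semialgebraicC (semialgebraic_lt pg pf)).
by move=> x /=; rewrite leNgt; split=> /negP.
Qed.

Lemma semialgebraic_all_ord n k (B : 'I_k -> set 'rV[R]_n) :
  (forall i, semialgebraic (B i)) -> semialgebraic [set x | forall i, B i x].
Proof.
move=> sB.
suff /(_ (enum 'I_k)) : forall s : seq 'I_k,
    semialgebraic [set x | forall i, i \in s -> B i x].
  apply: eq_semialgebraic => x /=; split=> Bx i; last by move=> _; exact: Bx.
  by apply: Bx; rewrite mem_enum.
elim=> [|i s IHs]; first by apply: eq_semialgebraic (semialgebraicT n) => x.
apply: eq_semialgebraic (semialgebraicI (sB i) IHs) => x /=.
split=> [[Bx sx] j|Bx]; first by rewrite inE => /predU1P[->|/sx].
by split=> [|j js]; apply: Bx; rewrite inE ?eqxx// js orbT.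
Qed.

End Semialgebraic.

(** Follows the syntax of an expression to settle [polyfun] and [polymap] goals, so that polynomials
    in several blocks of variables can be given as functions. *)
Ltac polynomial := repeat first
  [ exact: polymap_id | exact: polyfun_cst | apply: polymap_lsub
  | apply: polymap_rsub | apply: polymap_row | apply: polymap_scalar
  | apply: polyfunD | apply: polyfunN | apply: polyfunM | apply: polyfunX
  | apply: polyfun_comp | apply: polyfun_sum => ? | apply: polyfun_coord ].

(** * Value functions are semialgebraic *)

Section ValueFunctions.
Variables (R : realType) (n : nat).
Implicit Type h : 'rV[R]_n -> \bar R.

(** The relation [h x < t] determines [h]: the value is [+oo] if it holds for no [t], [-oo] if it
    holds for all [t], and [t] itself if it fails at [t] and holds at every [s > t]. *)
Lemma SA_lt h :
  semialgebraic [set w : 'rV_(n + 1) | (h (lsubmx w) < (rsubmx w 0 0)%:E)%E] ->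
  SA R n h.
Proof.
move=> sh.
have y1 (s : R) : (s%:M : 'rV[R]_1) 0 0 = s by rewrite mxE eqxx mulr1n.
have sp : semialgebraic [set x | h x = +oo%E].
  have := semialgebraicC (@semialgebraic_ex _ _ _
    (fun x (t : 'rV_1) => h x < (t 0 0)%:E)%E sh).
  apply: eq_semialgebraic => x /=; split=> [/forallNP hx|-> [t]//].
  case: (h x) hx => [r|//|] hx.
    by have := hx (r + 1)%:M; rewrite y1 lte_fin ltrDl ltr01.
  by have := hx 0; rewrite ltNyr.
have sm : semialgebraic [set x | h x = -oo%E].
  have := @semialgebraic_all _ _ _
    (fun x (t : 'rV_1) => h x < (t 0 0)%:E)%E sh.
  apply: eq_semialgebraic => x /=; split=> [hx|-> t]; last by rewrite ltNyr.
  case: (h x) hx => [r|/(_ 0)|//] //.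
  by move=> /(_ r%:M); rewrite y1 ltxx.
split=> //.
  apply: eq_semialgebraic (semialgebraicI (semialgebraicC sp) (semialgebraicC sm)).
  by move=> x /=; case: (h x) => //; split=> // -[].
(* These are the pairs of [x] and [t] with [h x = t], the alternative [s <= t] encoding that only
   [s > t] is tested. *)
have sg : semialgebraic [set w : 'rV_(n + 1) | forall s : 'rV_1,
    ~ (h (lsubmx w) < (rsubmx w 0 0)%:E)%E /\
    (s 0 0 <= rsubmx w 0 0 \/ (h (lsubmx w) < (s 0 0)%:E)%E)].
  apply: (@semialgebraic_all _ _ _ (fun w (s : 'rV_1) =>
    ~ (h (lsubmx w) < (rsubmx w 0 0)%:E)%E /\
    (s 0 0 <= rsubmx w 0 0 \/ (h (lsubmx w) < (s 0 0)%:E)%E))).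
  apply: semialgebraicI.
    apply: (@semialgebraic_preimage _ _ _ (fun w => lsubmx w)
      (~` [set w : 'rV_(n + 1) | (h (lsubmx w) < (rsubmx w 0 0)%:E)%E])).
      by polynomial.
    exact: semialgebraicC.
  apply: semialgebraicU; first by apply: semialgebraic_le; polynomial.
  have /semialgebraic_preimage/(_ sh) : polymap (fun w : 'rV[R]_((n + 1) + 1) =>
    row_mx (lsubmx (lsubmx w)) (rsubmx w)) by polynomial.
  by apply: eq_semialgebraic => w /=; rewrite row_mxKl row_mxKr.
apply: eq_semialgebraic sg => w; split=> /=.
  move=> hw; have hwt : h (lsubmx w) = (rsubmx w 0 0)%:E.
    apply/eqP; rewrite eq_le; apply/andP; split; last first.
      by rewrite leNgt; apply/negP; case: (hw 0).
    apply/lee_addgt0Pr => e e0; rewrite -EFinD.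
    (* Testing at [s = t + e] for every [e > 0] yields [h x <= t]. *)
    have [_] := hw (rsubmx w 0 0 + e)%:M; rewrite y1 => -[|/ltW//].
    by rewrite gerDl leNgt e0.
  exists (lsubmx w); rewrite /= ?hwt//= -[RHS]hsubmxK; congr row_mx.
  by apply/rowP => i; rewrite ord1 y1.
case=> x fx <- s; rewrite row_mxKl row_mxKr y1.
rewrite -[X in (X < _)%E](fineK fx) -[X in _ \/ (X < _)%E](fineK fx) !lte_fin ltxx.
by split=> //; case: leP; [left|right].
Qed.

(** The two infinite loci are exchanged, and the graph is pulled back along the reflection of its
    last coordinate. *)
Lemma SAN h : SA R n h -> SA R n (fun x => - h x)%E.
Proof.
case=> sf sp sm sg; split.
- by apply: eq_semialgebraic sf => x /=; rewrite fin_numN.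
- apply: eq_semialgebraic sm => x /=; split=> [->//|/eqP].
  by rewrite eqe_oppLR => /eqP.
- apply: eq_semialgebraic sp => x /=; split=> [->//|/eqP].
  by rewrite eqe_oppLR => /eqP.
have /semialgebraic_preimage/(_ sg) : polymap (fun w : 'rV[R]_(n + 1) =>
  row_mx (lsubmx w) (- rsubmx w 0 0)%:M) by polynomial.
apply: eq_semialgebraic => w; split=> -[x /= fx xw].
  exists x; rewrite /= ?fin_numN// -[w]hsubmxK.
  have [-> /rowP/(_ 0)] := eq_row_mx xw.
  rewrite fineN 2!mxE eqxx !mulr1n => ->; rewrite opprK; congr row_mx.
  by apply/rowP => i; rewrite ord1 mxE eqxx mulr1n.
exists x; first by move: fx; rewrite fin_numN.
by rewrite -xw row_mxKl row_mxKr fineN mxE eqxx mulr1n opprK.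
Qed.

Lemma semialgebraic_box m (a b : 'I_m -> \bar R) : semialgebraic (box a b).
Proof.
apply: semialgebraic_all_ord => i.
have sa : semialgebraic [set y : 'rV[R]_m | (a i <= (y 0 i)%:E)%E].
  case: (a i) => [r||].
  - by under eq_set do rewrite lee_fin; apply: semialgebraic_le; polynomial.
  - by apply: eq_semialgebraic (semialgebraic0 _ _) => y /=; rewrite leye_eq.
  - by apply: eq_semialgebraic (semialgebraicT _ _) => y /=; rewrite leNye.
have sb : semialgebraic [set y : 'rV[R]_m | ((y 0 i)%:E <= b i)%E].
  case: (b i) => [r||].
  - by under eq_set do rewrite lee_fin; apply: semialgebraic_le; polynomial.
  - by apply: eq_semialgebraic (semialgebraicT _ _) => y /=; rewrite leey.
  - by apply: eq_semialgebraic (semialgebraic0 _ _) => y /=; rewrite leeNy_eq.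
by apply: eq_semialgebraic (semialgebraicI sa sb) => y /=; split=> /andP.
Qed.

(** An infimum is below [t] exactly when some element is, whether or not it is attained and also for
    the empty set. So the strict comparison needed by [SA_lt] says that some minimizer [y] has [P]
    below [t]. *)
Lemma optim_value_SA m (P Q : {mpoly R[n + m]}) (Y : set 'rV[R]_m) :
  semialgebraic Y -> SA R n (optim_value P Q Y).
Proof.
move=> sY; apply: SA_lt.
have sM : semialgebraic [set w : 'rV_(n + m) |
    lower_argmin Q Y (lsubmx w) (rsubmx w)].
  apply: semialgebraicI; first by apply: semialgebraic_preimage sY; polynomial.
  apply: (@semialgebraic_all _ _ _ (fun (w : 'rV_(n + m)) z => Y z ->
    evalp Q (row_mx (lsubmx w) (rsubmx w)) <= evalp Q (row_mx (lsubmx w) z))).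
  have sYz : semialgebraic [set w : 'rV_(n + m + m) | Y (rsubmx w)].
    by apply: semialgebraic_preimage sY; polynomial.
  have sQ : semialgebraic [set w : 'rV_(n + m + m) |
      evalp Q (row_mx (lsubmx (lsubmx w)) (rsubmx (lsubmx w))) <=
      evalp Q (row_mx (lsubmx (lsubmx w)) (rsubmx w))].
    by apply: semialgebraic_le; polynomial.
  (* The implication from [Y z] becomes a union with the complement of [Y]. *)
  apply: eq_semialgebraic (semialgebraicU (semialgebraicC sYz) sQ) => w /=.
  split=> [[//|//]|wQ].
  by have [Yw|] := pselect (Y (rsubmx w)); [right; exact: wQ|left].
have sE : semialgebraic [set w : 'rV_(n + 1) | exists y : 'rV_m,
    lower_argmin Q Y (lsubmx w) y /\ evalp P (row_mx (lsubmx w) y) < rsubmx w 0 0].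
  apply: (@semialgebraic_ex _ _ _ (fun (w : 'rV_(n + 1)) y =>
    lower_argmin Q Y (lsubmx w) y /\ evalp P (row_mx (lsubmx w) y) < rsubmx w 0 0)).
  apply: semialgebraicI; last by apply: semialgebraic_lt; polynomial.
  have /semialgebraic_preimage/(_ sM) : polymap (fun w : 'rV[R]_(n + 1 + m) =>
    row_mx (lsubmx (lsubmx w)) (rsubmx w)) by polynomial.
  by apply: eq_semialgebraic => w /=; rewrite row_mxKl row_mxKr.
apply: eq_semialgebraic sE => w /=; split=> [[y [yM yP]]|].
  by apply/ereal_inf_ltP; exists (evalp P (row_mx (lsubmx w) y))%:E => //; exists y.
by move=> /ereal_inf_ltP[_ [y yM <-]]; rewrite lte_fin => yP; exists y.
Qed.

(** The minimizers depend on [Q] alone, and a supremum is minus the infimum of the opposites. *)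
Lemma pessim_valueE m (P Q : {mpoly R[n + m]}) (Y : set 'rV[R]_m) x :
  pessim_value P Q Y x = (- optim_value (- P) Q Y x)%E.
Proof.
rewrite /pessim_value /optim_value ereal_supEN image_comp.
by congr (- ereal_inf _)%E; apply: eq_imagel => y _ /=; rewrite evalpN.
Qed.

End ValueFunctions.

(** * Semialgebraic functions as value functions of unconstrained problems *)

Section Representation.
Variable R : realType.

(** Nonnegativity of [F] is recorded because it later turns the zeros of [F] into minimizers. *)
Lemma semialgebraic_zeros n (A : set 'rV[R]_n) : semialgebraic A ->
  exists k (F : {mpoly R[n + k]}), (forall w, 0 <= evalp F w) /\
    forall x, A x <-> exists z, evalp F (row_mx x z) = 0.
Proof.
pose zeros (A : set 'rV[R]_n) := exists k (F : {mpoly R[n + k]}),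
  (forall w, 0 <= evalp F w) /\
  forall x, A x <-> exists z, evalp F (row_mx x z) = 0.
have zeros_basic (B : set 'rV[R]_n) : basic_semialgebraic B -> zeros B.
  move=> [k [P [Q ->]]]; exists k.
  have [F FE] : polyfun (fun w : 'rV[R]_(n + k) => evalp P (lsubmx w) ^+ 2 +
    \sum_j (evalp (Q j) (lsubmx w) * rsubmx w 0 j ^+ 2 + - 1) ^+ 2) by polynomial.
  exists F; split=> [w|x].
    by rewrite FE addr_ge0 ?sqr_ge0 ?sumr_ge0// => j _; exact: sqr_ge0.
  split=> /= [[P0 Qx]|[z]].
    (* The solution [z_j = 1 / sqrt(Q_j)] of [Q_j z_j^2 = 1]. *)
    exists (\row_j Num.sqrt (evalp (Q j) x)^-1).
    rewrite FE row_mxKl row_mxKr P0 expr0n add0r big1// => j _.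
    rewrite mxE sqr_sqrtr ?invr_ge0 ?ltW// divff ?gt_eqF//.
    by rewrite subrr expr0n.
  (* All squares in a vanishing sum vanish, and [Q_j z_j^2 = 1] forces [Q_j > 0]. *)
  rewrite FE row_mxKl row_mxKr => /eqP; rewrite paddr_eq0 ?sqr_ge0//; last first.
    by rewrite sumr_ge0// => j _; exact: sqr_ge0.
  rewrite sqrf_eq0 => /andP[/eqP P0 /eqP].
  move/psumr_eq0P => S0; split=> // j.
  have /eqP := S0 (fun j _ => sqr_ge0 _) j isT.
  rewrite sqrf_eq0 subr_eq0 => /eqP Qz.
  have : 0 < evalp (Q j) x * z 0 j ^+ 2 by rewrite Qz.
  by rewrite pmulr_lgt0//; rewrite lt0r sqr_ge0 andbT; apply/eqP => z0;
    move: Qz; rewrite z0 mulr0 => /eqP; rewrite eq_sym oner_eq0.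
have zerosU (B C : set 'rV[R]_n) : zeros B -> zeros C -> zeros (B `|` C).
  (* Each factor of the product gets its own auxiliary variables; those of the factor that need not
     vanish are set to 0. *)
  move=> [k [F [F0 FB]]] [l [G [G0 GC]]]; exists (k + l)%N.
  have [H HE] : polyfun (fun w : 'rV[R]_(n + (k + l)) =>
    evalp F (row_mx (lsubmx w) (lsubmx (rsubmx w))) *
    evalp G (row_mx (lsubmx w) (rsubmx (rsubmx w)))) by polynomial.
  exists H; split=> [w|x /=]; first by rewrite HE mulr_ge0.
  rewrite FB GC; split=> [[[z Fz]|[z Gz]]|[z]].
  - by exists (row_mx z 0); rewrite HE !row_mxKr !row_mxKl Fz mul0r.
  - by exists (row_mx 0 z); rewrite HE !row_mxKr !row_mxKl Gz mulr0.
  rewrite HE row_mxKr row_mxKl => /eqP; rewrite mulf_eq0 => /orP[]/eqP FG.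
    by left; eexists; exact: FG.
  by right; eexists; exact: FG.
move=> [k [B [bB ->]]]; rewrite -/(zeros _).
elim: k B bB => [|k IHk] B bB.
  (* The empty union is the zero set of the constant 1. *)
  exists 0%N, 1; split=> [w|x]; rewrite /evalp ?meval1//.
  by split=> [[[]]//|[z /eqP]]; rewrite meval1 oner_eq0.
have := zerosU _ _ (zeros_basic _ (bB ord0)) 
  (IHk (fun i => B (lift ord0 i)) (fun i => bB _)).
congr zeros; apply/seteqP; split=> x.
  by case=> [Bx|[i _ Bx]]; [exists ord0|exists (lift ord0 i)].
by case=> i _; have [j ->|->] := unliftP ord0 i; [right; exists j|left].
Qed.

Lemma SA_optim_value n (h : 'rV[R]_n -> \bar R) : SA R n h ->
  exists m (P Q : {mpoly R[n + m]}), (0 < m)%N /\ optim_value P Q setT = h.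
Proof.
case=> _ _ sm sg.
pose A (w : 'rV[R]_(n + 1)) :=
  h (lsubmx w) = (rsubmx w 0 0)%:E \/ h (lsubmx w) = -oo%E.
have /semialgebraic_zeros[k [F [F0 FA]]] : semialgebraic A.
  have sm' : semialgebraic [set w : 'rV_(n + 1) | h (lsubmx w) = -oo%E].
    by apply: semialgebraic_preimage sm; polynomial.
  apply: eq_semialgebraic (semialgebraicU sg sm') => w; rewrite /A /=.
  split=> -[]; [|by right| |by right].
    by case=> x fx <-; left; rewrite row_mxKl row_mxKr mxE eqxx mulr1n fineK.
  move=> hw; left; exists (lsubmx w); rewrite /= ?hw//= -[RHS]hsubmxK.
  by congr row_mx; apply/rowP => i; rewrite ord1 mxE eqxx mulr1n.
(* The lower-level variable consists of the blocks [t], [z], [u], [v], in this order. *)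
exists (1 + (k + (1 + 1)))%N.
have [P PE] : polyfun (fun w : 'rV[R]_(n + (1 + (k + (1 + 1)))) =>
  lsubmx (rsubmx w) 0 0) by polynomial.
pose f (w : 'rV[R]_(n + (1 + (k + (1 + 1))))) :=
  evalp F (row_mx (row_mx (lsubmx w) (lsubmx (rsubmx w)))
                  (lsubmx (rsubmx (rsubmx w)))).
pose g (w : 'rV[R]_(n + (1 + (k + (1 + 1))))) :=
  let u := lsubmx (rsubmx (rsubmx (rsubmx w))) 0 0 in
  let v := rsubmx (rsubmx (rsubmx (rsubmx w))) 0 0 in
  (u * v + - 1) ^+ 2 + u ^+ 2.
have [Q QE] : polyfun (fun w => f w * g w) by rewrite /f /g; polynomial.
exists P, Q; split=> //.
have f0 w : 0 <= f w by exact: F0.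
have g0 w : 0 < g w.
  rewrite /g; set u := lsubmx _ 0 0; set v := rsubmx _ 0 0.
  rewrite lt0r addr_ge0 ?sqr_ge0// andbT; apply/eqP => /sumsqr_eq0[uv u0].
  by move: uv; rewrite u0 mul0r add0r => /eqP; rewrite oppr_eq0 oner_eq0.
have argminE x y : lower_argmin Q setT x y <-> f (row_mx x y) = 0.
  rewrite /lower_argmin /=; split=> [[_ Qmin]|fy]; last first.
    by split=> // z _; rewrite !QE fy mul0r mulr_ge0// ltW.
  apply/eqP; apply: contraT => fn0.
  have fp : 0 < f (row_mx x y) by rewrite lt0r fn0 f0.
  (* Taking [u = e] and [v = 1 / e] keeps [f] and brings [g] down to [e^2], half its value. Where
     [f] is positive this lowers the objective, so the point is no minimizer. *)
  pose e := Num.sqrt (g (row_mx x y) / 2).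
  have e0 : 0 < e by rewrite sqrtr_gt0 divr_gt0 ?g0.
  have := Qmin (row_mx (lsubmx y) (row_mx (lsubmx (rsubmx y))
    (row_mx (e%:M : 'rV_1) (e^-1%:M : 'rV_1)))) I.
  rewrite !QE [in X in _ <= X]/f !(row_mxKl, row_mxKr).
  rewrite -/(f _).
  have -> : evalp F (row_mx (row_mx x (lsubmx y)) (lsubmx (rsubmx y))) =
    f (row_mx x y) by rewrite /f !(row_mxKl, row_mxKr).
  rewrite ler_pM2l// [in X in _ <= X]/g !(row_mxKl, row_mxKr) !mxE eqxx !mulr1n.
  rewrite divff ?gt_eqF// subrr expr0n add0r sqr_sqrtr; last first.
    by rewrite divr_ge0// ltW.
  by rewrite leNgt; have := g0 (row_mx x y); lra.
apply/funext => x; rewrite /optim_value.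
have -> : [set (evalp P (row_mx x y))%:E | y in lower_argmin Q setT x] =
    [set t%:E | t in [set t : R | h x = t%:E \/ h x = -oo%E]].
  apply/seteqP; split=> _ [y yA <-].
    move/argminE : yA => fy; exists (evalp P (row_mx x y)) => //=.
    have /(FA _).2 : exists z, evalp F (row_mx (row_mx x (lsubmx y)) z) = 0.
      by eexists; move: fy; rewrite /f !(row_mxKl, row_mxKr); exact.
    by rewrite /A PE !(row_mxKl, row_mxKr).
  have /(FA _).1[z Fz] : A (row_mx x (y%:M : 'rV_1)).
    by rewrite /A row_mxKl row_mxKr mxE eqxx mulr1n.
  (* As [f] ignores [u] and [v], they may be taken to be 0. *)
  exists (row_mx (y%:M : 'rV_1) (row_mx z 0)).
    by apply/argminE; rewrite /f !(row_mxKl, row_mxKr).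
  by rewrite PE !(row_mxKl, row_mxKr) mxE eqxx mulr1n.
(* The set of values is a single point, empty or the whole line, according to whether [h x] is
   finite, [+oo] or [-oo]. *)
case: (h x) => [r||].
- rewrite (_ : [set _ | _ in _] = [set r%:E]) ?ereal_inf1//.
  apply/seteqP; split=> [_ [t [[->]|//] <-]//|_ ->].
  by exists r => //; left.
- rewrite (_ : [set _ | _ in _] = set0) ?ereal_inf0//.
  by apply/seteqP; split=> // e [t []].
- rewrite (_ : [set _ | _ in _] = range EFin) ?ereal_inf_real//.
  by apply/seteqP; split=> _ [t _ <-]; exists t => //; right.
Qed.

Lemma SA_pessim_value n (h : 'rV[R]_n -> \bar R) : SA R n h ->
  exists m (P Q : {mpoly R[n + m]}), (0 < m)%N /\ pessim_value P Q setT = h.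
Proof.
move=> /SAN/SA_optim_value[m [P [Q [m0 PQ]]]]; exists m, (- P), Q; split=> //.
by apply/funext => x; rewrite pessim_valueE opprK PQ oppeK.
Qed.

(** * Equality of the three classes *)

Lemma boxT m : box (fun _ : 'I_m => -oo%E) (fun=> +oo%E) = [set: 'rV[R]_m].
Proof. by apply/seteqP; split=> y //= _ i; rewrite leNye leey. Qed.

(** In dimension 0 there is no bound that could be infinite, which is why the representations above
    keep track of [0 < m]. *)
Lemma unbounded_boxT m : (0 < m)%N ->
  unbounded_box (fun _ : 'I_m => -oo%E : \bar R) (fun=> +oo%E).
Proof. by move=> m0; exists (Ordinal m0); left. Qed.

Lemma optim_unboundE n : optim_unbound R n = SA R n.
Proof.
apply/seteqP; split=> h.
  by move=> [m [P [Q [a [b [_ <-]]]]]]; exact/optim_value_SA/semialgebraic_box.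
move=> /SA_optim_value[m [P [Q [m0 PQ]]]].
by exists m, P, Q, (fun=> -oo%E), (fun=> +oo%E); 
  split; [exact: unbounded_boxT|rewrite boxT].
Qed.

Lemma pessim_unboundE n : pessim_unbound R n = SA R n.
Proof.
apply/seteqP; split=> h.
  move=> [m [P [Q [a [b [_ <-]]]]]].
  rewrite (_ : pessim_value _ _ _ =
    fun x => (- optim_value (- P) Q (box a b) x)%E).
    exact/SAN/optim_value_SA/semialgebraic_box.
  by apply/funext => x; exact: pessim_valueE.
move=> /SA_pessim_value[m [P [Q [m0 PQ]]]].
by exists m, P, Q, (fun=> -oo%E), (fun=> +oo%E); 
  split; [exact: unbounded_boxT|rewrite boxT].
Qed.

End Representation.

Theorem theorem2p12 (R : realType) (n : nat) :
  (forall h : 'rV[R]_n -> \bar R, SA R n h ->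
     (exists (m : nat) (P Q : {mpoly R[n + m]}),
        (0 < m)%N /\ optim_value P Q [set: 'rV[R]_m] = h) /\
     (exists (m : nat) (P Q : {mpoly R[n + m]}),
        (0 < m)%N /\ pessim_value P Q [set: 'rV[R]_m] = h)) /\
  optim_unbound R n = pessim_unbound R n /\
  pessim_unbound R n = SA R n.
Proof.
split; last by rewrite optim_unboundE pessim_unboundE.
by move=> h sh; split; [exact: SA_optim_value|exact: SA_pessim_value].
Qed.
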